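(* Let $\mathbb{T}^6=\mathbb{R}^6/\mathbb{Z}^6$ be the $6$-dimensional torus. There exists a smooth family $(\omega_t,J_t,\psi_t)$, $t\in\mathbb{R}$, of symplectic half-flat structures on $\mathbb{T}^6$ such that $(\omega_0,J_0,\psi_0)$ is the standard Calabi-Yau structure on $\mathbb{T}^6$, and such that for every $t\neq 0$ the structure $(\omega_t,J_t,\psi_t)$ is not integrable (i.e. the almost complex structure $J_t$ is not integrable).
   Context: An $\mathrm{SU}(3)$-structure on a $6$-dimensional smooth manifold $M$ is a triple $(\omega,J,\psi)$ where: $\omega$ is a non-degenerate $2$-form on $M$; $J$ is an $\omega$-calibrated almost complex structure on $M$, i.e. an almost complex structure such that $g_J(\cdot,\cdot)=\omega(\cdot,J\cdot)$ is an almost Hermitian metric (a $J$-invariant Riemannian metric); and $\psi$ is a nowhere vanishing complex form of type $(3,0)$ with respect to $J$ satisfying $\psi\wedge\overline{\psi}=-\frac{4}{3}i\,\omega^3$. The $\mathrm{SU}(3)$-structure is called symplectic half-flat if $d\omega=0$ and $d(\mathrm{Re}\,\psi)=0$. An almost complex structure $J$ is integrable if its Nijenhuis tensor $N_J(X,Y)=[JX,JY]-J[JX,Y]-J[X,JY]-[X,Y]$ vanishes identically. Let $(x_1,\dots,x_6)$ be the standard coordinates on $\mathbb{R}^6$. The standard Calabi-Yau structure on $\mathbb{T}^6$ is the one induced by $\omega_0=dx_1\wedge dx_4+dx_2\wedge dx_5+dx_3\wedge dx_6$, $J_0(\partial/\partial x_r)=\partial/\partial x_{3+r}$, $J_0(\partial/\partial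 x_{3+r})=-\partial/\partial x_r$ for $r=1,2,3$, and $\psi_0=i(dx_1+i\,dx_4)\wedge(dx_2+i\,dx_5)\wedge(dx_3+i\,dx_6)$. *)

(* Defs.v *)
From HB Require Import structures.
From mathcomp Require Import all_boot all_order all_algebra all_fingroup.
From mathcomp Require Import all_classical all_reals all_analysis.
From mathcomp.real_closed Require Import complex.

Set Implicit Arguments.
Unset Strict Implicit.
Unset Printing Implicit Defensive.

Import Order.TTheory GRing.Theory Num.Theory numFieldNormedType.Exports.
Local Open Scope ring_scope.
Local Open Scope complex_scope.

(** The torus R^n/Z^n has the global frame d/dx_1, ..., d/dx_n, so its tensor
    fields are the Z^n-periodic tensor fields of R^n.  Points and tangent
    vectors are both columns of type ['cV[R]_n]; an endomorphism field is
    matrix valued and acts on tangent vectors by left multiplication. *)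

(** C^k and smooth maps; meant for finite-dimensional [V] and [W], where
    existence and continuity of all iterated directional derivatives is the
    usual notion. *)
Fixpoint Ck {R : realType} {V W : normedModType R} (k : nat) (f : V -> W) :=
  if k is k'.+1 then
    (forall x, differentiable f x) /\ (forall v, Ck k' (fun x => 'D_v f x))
  else continuous f.

Definition smooth {R : realType} {V W : normedModType R} (f : V -> W) :=
  forall k, Ck k f.

Definition Zperiodic (R : realType) n (T : Type) (f : 'cV[R]_n -> T) :=
  forall (x : 'cV[R]_n) (m : 'cV[int]_n), f (x + map_mx intr m) = f x.

(** ** Exterior forms at a point *)

(** [T]-valued functions of [k] vectors of R^n, with [T] either [R] or [R[i]];
    [alternating] singles out the real exterior forms, and a complex one is
    exterior when its real and imaginary parts are. *)
Definition extform (R : realType) (n k : nat) (T : Type) :=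
  ('I_k -> 'cV[R]_n) -> T.

Definition upd (R : realType) n k (v : 'I_k -> 'cV[R]_n) (j : 'I_k)
    (u : 'cV[R]_n) : 'I_k -> 'cV[R]_n :=
  fun i => if i == j then u else v i.

Definition alternating (R : realType) n k (a : extform R n k R) :=
  (forall v j c u w,
     a (upd v j (c *: u + w)) = c * a (upd v j u) + a (upd v j w)) /\
  (forall v i j, i != j -> v i = v j -> a v = 0).

(** Normalised so that dx_1 /\ ... /\ dx_k is the k-th minor determinant. *)
Definition wedge (R : realType) n (K : fieldType) p q
    (a : extform R n p K) (b : extform R n q K) : extform R n (p + q) K :=
  fun v => ((p`! * q`!)%N%:R)^-1 *
    \sum_(s : 'S_(p + q)) (-1) ^+ s * a (fun i => v (s (lshift q i)))
                                   * b (fun j => v (s (rshift p j))).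

Definition add_form (R : realType) n k (K : fieldType) (a b : extform R n k K) :
    extform R n k K := fun v => a v + b v.

Definition scale_form (R : realType) n k (K : fieldType) (c : K)
    (a : extform R n k K) : extform R n k K := fun v => c * a v.

Definition iC (R : realType) : R[i] := 0 +i* 1.

Definition Re_form (R : realType) n k (a : extform R n k R[i]) :
    extform R n k R := fun v => complex.Re (a v).

Definition Im_form (R : realType) n k (a : extform R n k R[i]) :
    extform R n k R := fun v => complex.Im (a v).

Definition conj_form (R : realType) n k (a : extform R n k R[i]) :
    extform R n k R[i] := fun v => conjc (a v).

Definition complexify_form (R : realType) n k (a : extform R n k R) :
    extform R n k R[i] := fun v => (a v)%:C.

(** C-multilinear extension to the complexified tangent space: expand
    [a (u_1 + i w_1, ..., u_k + i w_k)], [S] being the set of slots in which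
    the imaginary part is taken. *)
Definition Cextend (R : realType) n k (a : extform R n k R[i])
    (z : 'I_k -> 'cV[R[i]]_n) : R[i] :=
  \sum_(S : {set 'I_k}) iC R ^+ #|S| *
    a (fun j => if j \in S then map_mx (@complex.Im R) (z j)
              else map_mx (@complex.Re R) (z j)).

(** Type (p,q) with respect to J: the extension vanishes on arguments taken
    from T^{1,0} (for the slots in [S]) and T^{0,1} (for the others), the +i
    and -i eigenspaces of J, unless exactly [p] of them are in T^{1,0}. *)
Definition has_type (R : realType) n p q (J : 'M[R]_n)
    (a : extform R n (p + q) R[i]) :=
  forall (S : {set 'I_(p + q)}) (z : 'I_(p + q) -> 'cV[R[i]]_n),
    (forall j, map_mx (real_complex R) J *m z j =
               (if j \in S then iC R else - iC R) *: z j) ->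
    #|S| <> p -> Cextend a z = 0.

Definition vec2 (R : realType) n (u v : 'cV[R]_n) : 'I_2 -> 'cV[R]_n :=
  fun i => [:: u; v]`_i.

Definition nondegenerate2 (R : realType) n (w : extform R n 2 R) :=
  forall u, (forall v, w (vec2 u v) = 0) -> u = 0.

(** ** Differential forms and vector fields on the torus *)

Definition smooth_form (R : realType) (V : normedModType R) n k
    (a : V -> extform R n k R) :=
  forall v, smooth (fun x => a x v : R).

Definition smooth_Cform (R : realType) (V : normedModType R) n k
    (a : V -> extform R n k R[i]) :=
  smooth_form (fun x => Re_form (a x)) /\ smooth_form (fun x => Im_form (a x)).

Definition torus_form (R : realType) n k (a : 'cV[R]_n -> extform R n k R) :=
  [/\ forall x, alternating (a x), smooth_form a & Zperiodic a].

Definition torus_Cform (R : realType) n k (a : 'cV[R]_n -> extform R n k R[i]) :=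
  torus_form (fun x => Re_form (a x)) /\ torus_form (fun x => Im_form (a x)).

(** Invariant formula for d, evaluated on constant vector fields. *)
Definition ext_d (R : realType) n k (a : 'cV[R]_n -> extform R n k R) :
    'cV[R]_n -> extform R n k.+1 R :=
  fun x v => \sum_(j < k.+1)
    (-1) ^+ j * 'D_(v j) (fun y => a y (fun i => v (lift j i)) : R) x.

Definition closed_form (R : realType) n k (a : 'cV[R]_n -> extform R n k R) :=
  forall x v, ext_d a x v = 0.

Definition torus_field (R : realType) n (X : 'cV[R]_n -> 'cV[R]_n) :=
  smooth X /\ Zperiodic X.

Definition lie (R : realType) n (X Y : 'cV[R]_n -> 'cV[R]_n) :
    'cV[R]_n -> 'cV[R]_n :=
  fun x => 'D_(X x) Y x - 'D_(Y x) X x.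

Definition Jact (R : realType) n (J : 'cV[R]_n -> 'M[R]_n)
    (X : 'cV[R]_n -> 'cV[R]_n) : 'cV[R]_n -> 'cV[R]_n :=
  fun x => J x *m X x.

Definition nijenhuis (R : realType) n (J : 'cV[R]_n -> 'M[R]_n)
    (X Y : 'cV[R]_n -> 'cV[R]_n) : 'cV[R]_n -> 'cV[R]_n :=
  fun x => lie (Jact J X) (Jact J Y) x - J x *m lie (Jact J X) Y x
           - J x *m lie X (Jact J Y) x - lie X Y x.

Definition integrable_acs (R : realType) n (J : 'cV[R]_n -> 'M[R]_n) :=
  forall X Y, torus_field X -> torus_field Y ->
    forall x, nijenhuis J X Y x = 0.

(** ** SU(3)-structures on the 6-torus *)

Definition almost_complex (R : realType) n (J : 'cV[R]_n -> 'M[R]_n) :=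
  [/\ smooth J, Zperiodic J & forall x, J x *m J x = - 1%:M].

Definition calibrated_metric (R : realType) n (w : 'cV[R]_n -> extform R n 2 R)
    (J : 'cV[R]_n -> 'M[R]_n) (x u v : 'cV[R]_n) : R :=
  w x (vec2 u (J x *m v)).

Definition calibrated (R : realType) n (w : 'cV[R]_n -> extform R n 2 R)
    (J : 'cV[R]_n -> 'M[R]_n) :=
  let g := calibrated_metric w J in
  forall x, [/\ forall u v, g x u v = g x v u,
                forall u, u != 0 -> 0 < g x u u
              & forall u v, g x (J x *m u) (J x *m v) = g x u v].

Record SU3_structure (R : realType) (w : 'cV[R]_6 -> extform R 6 2 R)
    (J : 'cV[R]_6 -> 'M[R]_6) (psi : 'cV[R]_6 -> extform R 6 3 R[i]) : Prop := {
  su3_w_form : torus_form w;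
  su3_w_nondeg : forall x, nondegenerate2 (w x);
  su3_J : almost_complex J;
  su3_calibrated : calibrated w J;
  su3_psi_form : torus_Cform psi;
  su3_psi_nonvanishing : forall x, exists v, psi x v <> 0;
  su3_psi_type : forall x, @has_type R 6 3 0 (J x) (psi x);
  su3_volume : forall (x : 'cV[R]_6) (v : 'I_6 -> 'cV[R]_6),
    wedge (psi x) (conj_form (psi x)) v =
    scale_form (- (4%:R / 3%:R) * iC R)
      (complexify_form (wedge (wedge (w x) (w x)) (w x))) v }.

Definition symplectic_half_flat (R : realType)
    (w : 'cV[R]_6 -> extform R 6 2 R) (J : 'cV[R]_6 -> 'M[R]_6)
    (psi : 'cV[R]_6 -> extform R 6 3 R[i]) :=
  [/\ SU3_structure w J psi, closed_form w
    & closed_form (fun x => Re_form (psi x))].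

(** Smoothness of a family is joint smoothness in (t, x). *)
Definition smooth_family (R : realType)
    (w : R -> 'cV[R]_6 -> extform R 6 2 R) (J : R -> 'cV[R]_6 -> 'M[R]_6)
    (psi : R -> 'cV[R]_6 -> extform R 6 3 R[i]) :=
  [/\ smooth_form (fun p : R * 'cV[R]_6 => w p.1 p.2),
      smooth (fun p : R * 'cV[R]_6 => J p.1 p.2)
    & smooth_Cform (fun p : R * 'cV[R]_6 => psi p.1 p.2)].

(** ** The standard Calabi-Yau structure *)

(** The coordinate 1-form dx_r, with r from 1 to 6. *)
Definition dx (R : realType) (r : nat) : extform R 6 1 R :=
  fun v => v ord0 (inord r.-1) 0.
Arguments dx : clear implicits.

(** dx_r + i dx_{3+r}. *)
Definition dz (R : realType) (r : nat) : extform R 6 1 R[i] :=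
  add_form (complexify_form (dx R r))
           (scale_form (iC R) (complexify_form (dx R (3 + r)))).
Arguments dz : clear implicits.

Definition w_std (R : realType) : extform R 6 2 R :=
  add_form (add_form (wedge (dx R 1) (dx R 4)) (wedge (dx R 2) (dx R 5)))
           (wedge (dx R 3) (dx R 6)).
Arguments w_std : clear implicits.

(** The columns are the images of the coordinate vectors. *)
Definition J_std (R : realType) : 'M[R]_6 :=
  block_mx (0 : 'M[R]_3) (- 1%:M) 1%:M (0 : 'M[R]_3).

Definition psi_std (R : realType) : extform R 6 3 R[i] :=
  scale_form (iC R) (wedge (wedge (dz R 1) (dz R 2)) (dz R 3)).
Arguments psi_std : clear implicits.

(* Main.v *)
(** Put [a = t sin(2 pi x_3)] and consider the unimodular coframe
      [u_1 = e^a dx_1, u_4 = e^-a dx_4, u_2 = e^-a dx_2, u_5 = e^a dx_5,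
       u_3 = dx_3, u_6 = dx_6].
    The SU(3)-structure with the standard expression in this coframe has
    [w = w_0], hence [dw = 0], and
      [Re psi = dx_456 - dx_126 - e^(2a) dx_153 - e^(-2a) dx_423],
    which is closed since the two nonconstant coefficients depend on [x_3]
    only.  All pointwise conditions are pulled back from the standard structure
    by [D = diag(e^a, e^-a, 1, e^-a, e^a, 1)].  As [J d_1 = e^(2a) d_4] and
    [J d_3 = d_6], the Nijenhuis tensor is [N(d_1, d_3) = - (2 d_3 a) d_1],
    which does not vanish at [x = 0] unless [t = 0]. *)

Require Import Defs.
From HB Require Import structures.
From mathcomp Require Import all_boot all_order all_algebra all_fingroup.
From mathcomp Require Import all_classical all_reals all_analysis.
From mathcomp.real_closed Require Import complex.
From mathcomp Require Import ring.

Set Implicit Arguments.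
Unset Strict Implicit.
Unset Printing Implicit Defensive.

Import Order.TTheory GRing.Theory Num.Theory numFieldNormedType.Exports Defs.
Local Open Scope ring_scope.
Local Open Scope complex_scope.

(** * Smooth functions *)

Section SmoothFunctions.
Context {R : realType} {V W : normedModType R}.
Implicit Types (f g : V -> R) (F G : V -> W).

Lemma CkS k F : Ck k.+1 F -> Ck k F.
Proof.
elim: k F => [|k IH] F [dF DF]; first by move=> x; exact/differentiable_continuous.
by split=> // v; exact/IH/DF.
Qed.

Lemma Ck_cst k (c : W) : Ck k (fun _ : V => c).
Proof.
elim: k c => [|k IH] c; first by move=> x; exact: cvg_cst.
split=> [x|v]; first exact: differentiable_cst.
have -> : (fun x => 'D_v (fun=> c) x) = fun=> 0;
  last exact: IH.
by apply/funext => x; exact: derive_cst.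
Qed.

Lemma CkD k F G : Ck k F -> Ck k G -> Ck k (fun x => F x + G x).
Proof.
elim: k F G => [|k IH] F G; first by move=> cF cG x; exact: (cvgD (cF x) (cG x)).
move=> [dF DF] [dG DG]; split=> [x|v]; first exact: differentiableD.
have -> : (fun x => 'D_v (fun y => F y + G y) x) = fun x => 'D_v F x + 'D_v G x;
  last exact: (IH _ _ (DF v) (DG v)).
by apply/funext => x; rewrite -deriveD //; exact: diff_derivable.
Qed.

Lemma Ck_sum (I : Type) k (r : seq I) (F : I -> V -> W) :
  (forall i, Ck k (F i)) -> Ck k (fun x => \sum_(i <- r) F i x).
Proof.
move=> CF; elim: r => [|i r IH].
  rewrite (_ : (fun x => _) = fun=> 0); first exact: Ck_cst.
  by apply/funext => x; rewrite big_nil.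
rewrite (_ : (fun x => _) = fun x => F i x + \sum_(j <- r) F j x).
  exact: CkD.
by apply/funext => x; rewrite big_cons.
Qed.

Lemma CkZ k f (c : W) : Ck k f -> Ck k (fun x => f x *: c).
Proof.
elim: k f => [|k IH] f; first by move=> cf x; exact: (cvgZr_tmp (cf x)).
move=> [df Df]; split=> [x|v]; first exact: differentiableZl.
have -> : (fun x => 'D_v (fun y => f y *: c) x) = fun x => 'D_v f x *: c;
  last exact: (IH _ (Df v)).
apply/funext => x; rewrite !deriveE ?diffZl //; exact: differentiableZl.
Qed.

End SmoothFunctions.

Lemma CkM {R : realType} {V : normedModType R} k (f g : V -> R) :
  Ck k f -> Ck k g -> Ck k (fun x => f x * g x).
Proof.
elim: k f g => [|k IH] f g; first by move=> cf cg x; exact: (cvgM (cf x) (cg x)).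
move=> Cf Cg; have [df Df] := Cf; have [dg Dg] := Cg.
split=> [x|v]; first exact: differentiableM.
have -> : (fun x => 'D_v (fun y => f y * g y) x) =
    fun x => f x * 'D_v g x + g x * 'D_v f x.
  by apply/funext => x; rewrite -deriveM //; exact: diff_derivable.
by apply: CkD; [apply: IH (CkS Cf) (Dg v)|apply: IH (CkS Cg) (Df v)].
Qed.

Lemma smooth_cst {R : realType} {V W : normedModType R} (c : W) :
  smooth (fun _ : V => c).
Proof. by move=> k; exact: Ck_cst. Qed.

(** By the chain rule the derivative along [v] is [dh \o f] times that of [f]. Regularity of
    [dh \o f] is asked one order lower, so functions whose derivatives reproduce themselves up to
    sign and exchange can be treated by induction on [k]. *)
Lemma Ck_comp1 {R : realType} {V : normedModType R} k (h dh : R -> R)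
    (f : V -> R) :
  (forall x : R, is_derive x 1 h (dh x)) -> Ck k (dh \o f) -> Ck k.+1 f ->
  Ck k.+1 (h \o f).
Proof.
move=> hdh Cdh Cf; have [df Df] := Cf.
have dh' x : differentiable h x by apply/derivable1_diffP/ex_derive.
split=> [x|v]; first exact: differentiable_comp.
have -> : (fun x => 'D_v (h \o f) x) = fun x => (dh \o f) x * 'D_v f x.
  apply/funext => x; rewrite !deriveE //; last exact: differentiable_comp.
  rewrite diff_comp //= deriv1E; last exact/ex_derive.
  by rewrite derive1E derive_val mulrC.
exact: CkM Cdh (Df v).
Qed.

Section SmoothReal.
Context {R : realType} {V : normedModType R}.
Implicit Types (f g : V -> R).

Lemma smooth_expR f : smooth f -> smooth (fun x => expR (f x)).
Proof.
move=> Cf k; elim: k => [|k IH].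
  by move=> x; apply: continuous_comp; [exact: (Cf 0)|exact: continuous_expR].
exact: (@Ck_comp1 _ _ _ expR expR).
Qed.

(** Sine and cosine are each other's derivatives up to sign, so one induction on the order has to
    carry both. *)
Lemma smooth_sin_cos f :
  smooth f -> smooth (fun x => sin (f x)) /\ smooth (fun x => cos (f x)).
Proof.
move=> Cf; suff H k : Ck k (sin \o f) /\ Ck k (cos \o f).
  by split=> k; have [] := H k.
elim: k => [|k [IHs IHc]].
  by split=> x; apply: continuous_comp; by
    [exact: (Cf 0)|exact: continuous_sin|exact: continuous_cos].
split; first exact: (@Ck_comp1 _ _ _ sin cos).
apply: (@Ck_comp1 _ _ _ cos (fun x => - sin x)) => //.
rewrite (_ : _ \o _ = fun x => (sin \o f) x * -1).
  exact: CkM IHs (Ck_cst _ _).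
by apply/funext => x /=; rewrite mulrN1.
Qed.

Lemma smoothD f g : smooth f -> smooth g -> smooth (fun x => f x + g x).
Proof. by move=> Cf Cg k; exact: CkD. Qed.

Lemma smoothM f g : smooth f -> smooth g -> smooth (fun x => f x * g x).
Proof. by move=> Cf Cg k; exact: CkM. Qed.

Lemma smoothN f : smooth f -> smooth (fun x => - f x).
Proof.
move=> Cf; rewrite (_ : (fun _ => _) = fun x => -1 * f x).
  by apply: smoothM => //; exact: smooth_cst.
by apply/funext => x; rewrite mulN1r.
Qed.

(** A continuous linear map is its own differential, so each directional derivative is the constant
    [f v]. *)
Lemma smooth_linear (W : normedModType R) (f : V -> W) :
  linear f -> continuous f -> smooth f.
Proof.
move=> lf cf; pose L := GRing.isLinear.Build R V W _ f lf.
pose g : {linear V -> W} := HB.pack f L.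
have dg x : differentiable g x by exact: linear_differentiable.
case=> [|k] //; split=> // v.
rewrite (_ : (fun x => _) = fun=> f v); first exact: Ck_cst.
by apply/funext => x; rewrite deriveE // (@diff_lin _ _ _ g).
Qed.

Lemma smooth_mx m n (F : V -> 'M[R]_(m.+1, n.+1)) :
  (forall i j, smooth (fun x => F x i j)) -> smooth F.
Proof.
move=> CF k.
rewrite (_ : F = fun x => \sum_i \sum_j F x i j *: delta_mx i j); last first.
  by apply/funext => x; exact: matrix_sum_delta.
by apply: Ck_sum => i; apply: Ck_sum => j; apply: CkZ; exact: CF.
Qed.

End SmoothReal.

Lemma smooth_coord {R : realType} m n (i : 'I_m.+1) (j : 'I_n.+1) :
  smooth (fun x : 'M[R]_(m.+1, n.+1) => x i j).
Proof.
by apply: smooth_linear; [move=> a x y; rewrite !mxE|exact: coord_continuous].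
Qed.

(** * Smooth complex-valued functions, through real and imaginary parts *)

Section SmoothComplex.
Context {R : realType} {V : normedModType R}.
Implicit Types (f g : V -> R[i]).

Definition Csmooth f :=
  smooth (fun x => complex.Re (f x)) /\ smooth (fun x => complex.Im (f x)).

Lemma CsmoothD f g : Csmooth f -> Csmooth g -> Csmooth (fun x => f x + g x).
Proof.
move=> [fr fi] [gr gi]; split.
  rewrite (_ : (fun _ => _) = fun x => complex.Re (f x) + complex.Re (g x)).
    exact: smoothD.
  by apply/funext => x; case: (f x); case: (g x).
rewrite (_ : (fun _ => _) = fun x => complex.Im (f x) + complex.Im (g x)).
  exact: smoothD.
by apply/funext => x; case: (f x); case: (g x).
Qed.

Lemma CsmoothM f g : Csmooth f -> Csmooth g -> Csmooth (fun x => f x * g x).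
Proof.
move=> [fr fi] [gr gi]; split.
  rewrite (_ : (fun _ => _) = fun x => complex.Re (f x) * complex.Re (g x) +
      - (complex.Im (f x) * complex.Im (g x))).
    by apply: smoothD; [|apply: smoothN]; exact: smoothM.
  by apply/funext => x; case: (f x); case: (g x).
rewrite (_ : (fun _ => _) = fun x => complex.Re (f x) * complex.Im (g x) +
    complex.Im (f x) * complex.Re (g x)).
  by apply: smoothD; exact: smoothM.
by apply/funext => x; case: (f x); case: (g x).
Qed.

Lemma Csmooth_cst c : Csmooth (fun=> c).
Proof. by split; exact: smooth_cst. Qed.

Lemma Csmooth_det n (A : V -> 'M[R[i]]_n) :
  (forall i j, Csmooth (fun x => A x i j)) -> Csmooth (fun x => \det (A x)).
Proof.
move=> CA; rewrite /determinant.
elim: (index_enum _) => [|s r IH].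
  rewrite (_ : (fun x => _) = fun=> 0); first exact: Csmooth_cst.
  by apply/funext => x; rewrite big_nil.
rewrite (_ : (fun x => _) = fun x => (-1) ^+ s * \prod_i A x i (s i) +
    \sum_(t <- r) (-1) ^+ t * \prod_i A x i (t i)); last first.
  by apply/funext => x; rewrite big_cons.
apply: CsmoothD IH; apply: CsmoothM; first exact: Csmooth_cst.
elim: (index_enum _) => [|i l IH].
  rewrite (_ : (fun x => _) = fun=> 1); first exact: Csmooth_cst.
  by apply/funext => x; rewrite big_nil.
rewrite (_ : (fun x => _) = fun x => A x i (s i) * \prod_(j <- l) A x j (s j)).
  exact: CsmoothM.
by apply/funext => x; rewrite big_cons.
Qed.

End SmoothComplex.

(** * Wedge products of determinantal forms *)

(* Unlike [\det], this reduces by computation when [f] and [n] are concrete. *)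
Fixpoint laplace (K : pzRingType) n (f : nat -> nat -> K) : K :=
  if n is m.+1 then
    foldr (fun j s => (-1) ^+ j * f 0%N j *
             laplace m (fun i k => f i.+1 (bump j k)) + s) 0 (iota 0 n)
  else 1.

(** Cofactor expansion along row 0; [bump j] is the action of [lift j] on underlying naturals. *)
Lemma det_laplace (K : comPzRingType) n (f : nat -> nat -> K) :
  \det (\matrix_(i < n, j < n) f i j) = laplace n f.
Proof.
elim: n f => [|n IH] f; first by rewrite det_mx00.
have -> : laplace n.+1 f =
    \sum_(j <- iota 0 n.+1) (-1) ^+ j * f 0%N j *
       laplace n (fun i k => f i.+1 (bump j k)).
  rewrite /laplace -/laplace; elim: (iota _ _) => [|j r /= ->].
    by rewrite big_nil.
  by rewrite big_cons.
rewrite (expand_det_row _ ord0) -[iota 0 n.+1]/(index_iota 0 n.+1) big_mkord.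
apply: eq_bigr => j _; rewrite mxE /cofactor add0n -IH mulrCA mulrA.
by congr (_ * \det _); apply/matrixP => i k; rewrite !mxE.
Qed.

(** For linear [a i] this is the wedge product of the first [k] covectors. Indexing the covectors by
    [nat] lets degrees such as 3 + 3 and 6 be identified without casts. *)
Definition detform (R : realType) n (K : comPzRingType) k
    (a : nat -> 'cV[R]_n -> K) : extform R n k K :=
  fun v => \det (\matrix_(i < k, j < k) a i (v j)).
Arguments detform {R n K} k a.

Definition catrows T p (a b : nat -> T) i := if (i < p)%N then a i else b (i - p)%N.

Lemma catrows_lshift T p q (a b : nat -> T) (i : 'I_p) :
  catrows p a b (lshift q i) = a i.
Proof. by rewrite /catrows /= ltn_ord. Qed.

Lemma catrows_rshift T p q (a b : nat -> T) (i : 'I_q) :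
  catrows p a b (rshift p i) = b i.
Proof. by rewrite /catrows /= ltnNge leq_addr /= addKn. Qed.

(** * Block permutations and their signs *)

Section BlockPerm.
Variables (p q : nat) (s : 'S_p) (t : 'S_q).

Definition block_perm_fun (i : 'I_(p + q)) : 'I_(p + q) :=
  match fintype.split i with inl j => lshift q (s j) | inr j => rshift p (t j) end.

Lemma block_perm_fun_inj : injective block_perm_fun.
Proof.
move=> i j; rewrite /block_perm_fun.
case: split_ordP => k ->; case: split_ordP => l -> /eqP;
  by rewrite ?(eq_lshift, eq_rshift, eq_lrshift, eq_rlshift) //
     => /eqP/perm_inj ->.
Qed.

Definition block_perm := perm block_perm_fun_inj.

Lemma block_perm_lshift i : block_perm (lshift q i) = lshift q (s i).
Proof. by rewrite permE /block_perm_fun (unsplitK (inl _)). Qed.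

Lemma block_perm_rshift i : block_perm (rshift p i) = rshift p (t i).
Proof. by rewrite permE /block_perm_fun (unsplitK (inr _)). Qed.

(** The sign is the determinant of the permutation matrix, which here is block diagonal. *)
Lemma sign_block_perm (K : comPzRingType) :
  (-1) ^+ block_perm = (-1) ^+ s * (-1) ^+ t :> K.
Proof.
rewrite -!det_perm -(det_ublock _ 0); congr (\det _).
apply/matrixP => i j; rewrite !mxE.
case: (split_ordP i) => k ->; rewrite ?block_perm_lshift ?block_perm_rshift !mxE;
  case: (split_ordP j) => l ->; rewrite !mxE;
  by rewrite ?(eq_lshift, eq_rshift, eq_lrshift, eq_rlshift).
Qed.
End BlockPerm.

(** Expanding both determinants gives a sum over [s] and over pairs of permutations of the two
    blocks. For a fixed pair, translating [s] by the block permutation turns the sum over [s] into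
    the full determinant; the [p! * q!] equal copies cancel the normalisation of [wedge]. *)
Lemma wedge_detform (R : realType) n (K : numFieldType) p q
    (a b : nat -> 'cV[R]_n -> K) :
  wedge (detform p a) (detform q b) = detform (p + q) (catrows p a b).
Proof.
apply/funext => v; rewrite /wedge.
have nz : (p`! * q`!)%N%:R != 0 :> K by rewrite pnatr_eq0 -lt0n muln_gt0 !fact_gt0.
apply: (canLR (mulKf nz)); rewrite /detform [in RHS]/determinant.
pose c (i : 'I_(p + q)) u := catrows p a b i u.
transitivity (\sum_(s : 'S_(p + q)) \sum_(st : 'S_p * 'S_q)
    ((-1) ^+ (block_perm st.1 st.2 * s)%g *
      \prod_i c i (v ((block_perm st.1 st.2 * s)%g i)))).
  apply: eq_bigr => s _.
  rewrite -mulrA /determinant big_distrlr /= pair_bigA big_distrr /=.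
  apply: eq_bigr => -[t1 t2] _ /=.
  rewrite odd_permM signr_addb sign_block_perm big_split_ord /=.
  rewrite (eq_bigr (fun i : 'I_p => a i (v (s (lshift q (t1 i)))))); last first.
    by move=> i _; rewrite !mxE.
  rewrite (eq_bigr (fun i : 'I_q => b i (v (s (rshift p (t2 i)))))); last first.
    by move=> i _; rewrite !mxE.
  under [in RHS]eq_bigr do
    rewrite permM block_perm_lshift /c catrows_lshift.
  under [X in _ = _ * (_ * X)]eq_bigr do
    rewrite permM block_perm_rshift /c catrows_rshift.
  have E (x y z f g : K) : x * (y * f * (z * g)) = y * z * x * (f * g) by ring.
  exact: E.
rewrite exchange_big /=.
transitivity (\sum_(st : 'S_p * 'S_q) \sum_(s : 'S_(p + q))
   (-1) ^+ s * \prod_i c i (v (s i))).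
  apply: eq_bigr => st _.
  (* Left translation by the block permutation is a bijection of the symmetric group, so the inner
     sum does not depend on [st]. *)
  by rewrite [RHS](reindex_inj (mulgI (block_perm st.1 st.2))).
rewrite sumr_const card_prod !card_Sn mulr_natl; congr (_ *+ _).
apply: eq_bigr => s _; congr (_ * _); apply: eq_bigr => i _; by rewrite mxE.
Qed.

Section FormAlgebra.
Context {R : realType} {n : nat} {K : fieldType}.

Lemma wedge_sum (I J : Type) (r : seq I) (s : seq J) p q
    (a : I -> extform R n p K) (b : J -> extform R n q K) :
  wedge (fun v => \sum_(i <- r) a i v) (fun v => \sum_(j <- s) b j v) =
  fun v => \sum_(k <- [seq (i, j) | i <- r, j <- s]) wedge (a k.1) (b k.2) v.
Proof.
apply/funext => v; rewrite /wedge -big_distrr exchange_big /=; congr (_ * _).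
by apply: eq_bigr => t _; rewrite big_allpairs -mulrA big_distrlr big_distrr /=;
  apply: eq_bigr => i _; rewrite big_distrr; apply: eq_bigr => j _; exact: mulrA.
Qed.

Lemma wedgeZ p q k l (a : extform R n p K) (b : extform R n q K) :
  wedge (scale_form k a) (scale_form l b) = scale_form (k * l) (wedge a b).
Proof.
apply/funext => v; rewrite /wedge /scale_form [RHS]mulrCA [in RHS]big_distrr /=.
have E (x y z : K) : x * (k * y) * (l * z) = k * l * (x * y * z) by ring.
by congr (_ * _); apply: eq_bigr => s _; exact: E.
Qed.

Lemma eq_detform k (a b : nat -> 'cV[R]_n -> K) :
  (forall i, (i < k)%N -> a i = b i) -> detform k a = detform k b.
Proof.
move=> ab; apply/funext => v; congr (\det _); apply/matrixP => i j.
by rewrite !mxE ab.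
Qed.

End FormAlgebra.

(** Distributing the product over the slots of sums of a real and an imaginary term produces one
    summand per subset [S], which is the defining sum of [Cextend]. The transpose makes the products
    in the determinant run over slots. *)
Lemma Cextend_detform (R : realType) n k (a : nat -> 'cV[R]_n -> R[i])
    (z : 'I_k -> 'cV[R[i]]_n) :
  Cextend (detform k a) z =
  \det (\matrix_(i < k, j < k) (a i (map_mx (@complex.Re R) (z j)) +
                         iC R * a i (map_mx (@complex.Im R) (z j)))).
Proof.
rewrite -[RHS]det_tr /determinant /Cextend.
under [RHS]eq_bigr do under eq_bigr do rewrite !mxE addrC.
under [RHS]eq_bigr do rewrite bigA_distr big_distrr /=.
rewrite exchange_big /=; apply: eq_bigr => S _.
rewrite /detform -det_tr /determinant big_distrr /=; apply: eq_bigr => s _.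
rewrite mulrCA; congr (_ * _).
rewrite -prodr_const big_mkcond -big_split /=; apply: eq_bigr => j _.
by rewrite !mxE; case: ifP => _; rewrite ?mul1r.
Qed.

(** * The standard structure *)

Section Standard.
Context {R : realType}.
Implicit Types (u : 'cV[R]_6).

Definition coord_rows (f : nat -> nat) (i : nat) u : R := u (inord (f i)) 0.

(** Zero-based: row [i] is [dz R i.+1]. *)
Definition zrows (i : nat) u : R[i] :=
  (u (inord i) 0)%:C + iC R * (u (inord (3 + i)) 0)%:C.

Lemma dx_detform r : dx R r = detform 1 (coord_rows (fun=> r.-1)).
Proof. by apply/funext => v; rewrite /detform det_mx11 mxE. Qed.

Lemma dz_detform r : dz R r.+1 = detform 1 (fun=> zrows r).
Proof. by apply/funext => v; rewrite /detform det_mx11 mxE. Qed.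

Definition pair_row r (i : nat) := nth 0%N [:: r; 3 + r]%N i.

Lemma catrows_coord p f g :
  catrows p (coord_rows f) (coord_rows g) = coord_rows (catrows p f g).
Proof. by apply/funext => i; rewrite /coord_rows /catrows; case: ifP. Qed.

Lemma w_std_detform :
  w_std R = fun v =>
    \sum_(r <- iota 0 3) detform 2 (coord_rows (pair_row r)) v.
Proof.
rewrite /w_std !dx_detform !wedge_detform !catrows_coord.
apply/funext => v; rewrite !big_cons big_nil addr0 addrA.
by congr (_ + _ + _); apply: (congr1 (@^~ v)); apply: eq_detform => -[|[|]].
Qed.

Lemma psi_std_detform : psi_std R = scale_form (iC R) (detform 3 zrows).
Proof.
rewrite /psi_std !dz_detform !wedge_detform; congr scale_form.
by apply: eq_detform => -[|[|[|]]].
Qed.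

(** The rows picked out by [f] form a 0-1 selection matrix times the matrix of [v]. The determinant
    of the selection matrix is kept as an integer [laplace] so that it can be evaluated by
    computation. *)
Lemma detform_coord_rows f (v : 'I_6 -> 'cV[R]_6) :
  all (fun i => f i < 6)%N (iota 0 6) ->
  detform 6 (coord_rows f) v =
  (laplace 6 (fun i j => (f i == j)%:R : int))%:~R *
    \det (\matrix_(i < 6, j < 6) v j i 0).
Proof.
move=> /allP f6'.
have f6 (i : 'I_6) : (f i < 6)%N by apply: f6'; rewrite mem_iota ltn_ord.
rewrite -det_laplace -det_map_mx -det_mulmx; congr (\det _).
apply/matrixP => i j; rewrite !mxE (bigD1 (inord (f i))) //= big1 ?addr0.
  by rewrite !mxE inordK ?eqxx ?mul1r // f6.
by move=> k; rewrite !mxE -val_eqE /= inordK ?f6 // eq_sym => /negPf->; rewrite mul0r.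
Qed.

Lemma w_std_cubed (v : 'I_6 -> 'cV[R]_6) :
  wedge (wedge (w_std R) (w_std R)) (w_std R) v =
  - 6%:R * \det (\matrix_(i < 6, j < 6) v j i 0).
Proof.
rewrite w_std_detform !wedge_sum.
pose L := [seq (ij, k) | ij <- [seq (i, j) | i <- iota 0 3, j <- iota 0 3],
                         k <- iota 0 3].
rewrite -/L.
pose f (k : nat * nat * nat) :=
  catrows 4 (catrows 2 (pair_row k.1.1) (pair_row k.1.2)) (pair_row k.2).
rewrite (eq_big_seq (fun k => (laplace 6 (fun i j => (f k i == j)%:R : int))%:~R *
    \det (\matrix_(i < 6, j < 6) v j i 0))); last first.
  move=> k kL; rewrite !wedge_detform !catrows_coord detform_coord_rows //.
  by move: k kL; apply/allP.
rewrite -mulr_suml -rmorph_sum /=; congr (_ * _).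
(* Of the 27 terms of the cube only the 3! with distinct planes survive; each contributes -1, since
   the order 1,4,2,5,3,6 is an odd permutation. *)
have -> : \sum_(k <- L) laplace 6 (fun i j => (f k i == j)%:R : int) = - 6%:R.
  by rewrite unlock; vm_compute.
by rewrite rmorphN /= rmorph_nat.
Qed.

Lemma conj_iC : conjc (iC R) = - iC R.
Proof. by apply/eqP; rewrite eq_complex /= oppr0 !eqxx. Qed.

Lemma psi_std_volume (v : 'I_6 -> 'cV[R]_6) :
  wedge (psi_std R) (conj_form (psi_std R)) v =
  8%:R * iC R * (\det (\matrix_(i < 6, j < 6) v j i 0))%:C.
Proof.
rewrite psi_std_detform.
have -> : conj_form (scale_form (iC R) (detform 3 zrows)) =
    scale_form (- iC R) (detform 3 (fun i u => conjc (zrows i u))).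
  apply/funext => w; rewrite /conj_form /scale_form rmorphM /=.
  congr (_ * _); first exact: conj_iC.
  rewrite /detform -det_map_mx; congr (\det _).
  by apply/matrixP => i j; rewrite !mxE.
have iC2 : iC R * iC R = -1 by rewrite -expr2; exact: sqr_i.
rewrite wedgeZ wedge_detform /scale_form mulrN iC2 opprK mul1r.
set V := (X in _ = _ * (\det X)%:C).
(* The rows dz and their conjugates are obtained from the real coordinate rows through the
   coefficient matrix [B], so the form is [\det B] times the real volume. *)
pose CV : 'M[R[i]]_(3 + 3, 6) := map_mx (real_complex R) V.
pose B : 'M[R[i]]_(3 + 3) := block_mx 1%:M (iC R)%:M 1%:M (- iC R)%:M.
have -> : detform (3 + 3) (catrows 3 zrows (fun i u => conjc (zrows i u))) v =
    \det (B *m CV).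
  rewrite /detform -[CV]vsubmxK mul_block_col; congr (\det _).
  apply/matrixP => i j; rewrite mxE.
  have lt36 (k : 'I_3) : (k < 6)%N by rewrite (leq_trans (ltn_ord k)).
  have coordE (k : 'I_3) : zrows k (v j) =
      (V (lshift 3 k) j)%:C + iC R * (V (rshift 3 k) j)%:C.
    rewrite !mxE; congr (_%:C + _ * _%:C); congr (v _ _ _); apply/val_inj => /=.
      by rewrite inordK.
    by rewrite inordK // (ltn_ord (rshift 3 k)).
  case: (split_ordP i) => k ->.
    by rewrite col_mxEu catrows_lshift coordE !mul_scalar_mx !mxE mul1r.
  rewrite col_mxEd catrows_rshift coordE !mul_scalar_mx !mxE mul1r.
  by apply/eqP; rewrite eq_complex /=; apply/andP; split; apply/eqP; ring.
rewrite det_mulmx det_map_mx; congr (_ * _).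
(* Block elimination of the lower left corner, giving [\det B] = (-2i)^3 = 8i. *)
have -> : B = block_mx 1%:M 0 1%:M 1%:M *m block_mx 1%:M (iC R)%:M 0 (- 2%:R * iC R)%:M.
  rewrite mulmx_block !mul1mx !mul0mx !addr0.
  congr block_mx; rewrite -raddfD /=; congr (_%:M); ring.
rewrite det_mulmx det_lblock det_ublock !det1 !mul1r det_scalar.
rewrite exprMn.
have -> : iC R ^+ 3 = - iC R by rewrite exprSr expr2 iC2 mulN1r.
ring.
Qed.

End Standard.

(** * Multilinearity and alternation of determinantal forms *)

Section Alternating.
Context {R : realType} {n k : nat}.
Implicit Types (v : 'I_k -> 'cV[R]_n).

(** The map [phi] embeds the real scalars in [K]: it is the identity for real forms and [c%:C] for
    complex ones. *)
Lemma detform_updD (K : comPzRingType) (phi : R -> K) (a : nat -> 'cV[R]_n -> K) :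
  (forall i c u w, a i (c *: u + w) = phi c * a i u + a i w) ->
  forall v j c u w, detform k a (upd v j (c *: u + w)) =
    phi c * detform k a (upd v j u) + detform k a (upd v j w).
Proof.
move=> aD v j c u w; rewrite /detform -!(det_tr (\matrix_(_, _) _)).
rewrite -[X in _ = _ + X]mul1r; apply: (@determinant_multilinear _ _ _ _ _ j).
- by apply/rowP => i; rewrite !mxE /upd eqxx aD mul1r.
- by apply/matrixP => l i; rewrite !mxE /upd eq_sym (negPf (neq_lift _ _)).
- by apply/matrixP => l i; rewrite !mxE /upd eq_sym (negPf (neq_lift _ _)).
Qed.

Lemma detform_eq0 (K : comPzRingType) (a : nat -> 'cV[R]_n -> K) v i j :
  i != j -> v i = v j -> detform k a v = 0.
Proof.
move=> ij vij; rewrite /detform -det_tr; apply: (determinant_alternate ij) => l.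
by rewrite !mxE vij.
Qed.

Lemma alternating_sum (I : Type) (r : seq I) (a : I -> extform R n k R) :
  (forall i, alternating (a i)) -> alternating (fun v => \sum_(i <- r) a i v).
Proof.
move=> alt; split=> [v j c u w|v i j ij vij].
  by rewrite big_distrr -big_split /=; apply: eq_bigr => i _; case: (alt i) => ->.
by rewrite big1 // => l _; case: (alt l) => _; apply; [exact: ij|].
Qed.

End Alternating.

(** * Pullback of forms by a linear map *)

Section Pullback.
Context {R : realType} {n : nat}.

Definition pull k T (A : 'M[R]_n) (a : extform R n k T) : extform R n k T :=
  fun v => a (fun i => A *m v i).

Lemma alternating_pull k (A : 'M[R]_n) (a : extform R n k R) :
  alternating a -> alternating (pull A a).
Proof.
have updE v j u : (fun i => A *m upd v j u i) =
    upd (fun i => A *m v i) j (A *m u) :> ('I_k -> 'cV[R]_n).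
  by apply/funext => i; rewrite /upd; case: ifP.
case=> aD a0; split=> [v j c u w|v i j ij vij].
  by rewrite /pull !updE linearP aD.
by apply: a0 ij _; rewrite vij.
Qed.

Lemma mulmx_vec2 (A : 'M[R]_n) (u v : 'cV[R]_n) :
  (fun i => A *m vec2 u v i) = vec2 (A *m u) (A *m v).
Proof. by apply/funext => -[[|[|]]]. Qed.

End Pullback.

(** * Pointwise properties of the standard structure *)

Section StandardPointwise.
Context {R : realType}.

(** This is [J_std] over any ring, since the type condition on [psi] needs it acting on complexified
    vectors. *)
Definition J_mx (K : pzRingType) : 'M[K]_(3 + 3) := block_mx 0 (- 1%:M) 1%:M 0.

Lemma J_mx_mul (K : pzRingType) (v : 'cV[K]_6) (r : nat) : (r < 3)%N ->
  (J_mx K *m v) (inord r) 0 = - v (inord (3 + r)) 0 /\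
  (J_mx K *m v) (inord (3 + r)) 0 = v (inord r) 0.
Proof.
move=> r3.
have -> : inord r = lshift 3 (Ordinal r3).
  by apply/val_inj; rewrite /= inordK // (leq_trans r3).
have -> : inord (3 + r) = rshift 3 (Ordinal r3).
  by apply/val_inj; rewrite /= inordK // -[6%N]/(3 + 3)%N ltn_add2l.
have -> : J_mx K *m v = col_mx (- @dsubmx _ 3 3 _ v) (@usubmx _ 3 3 _ v).
  rewrite -[in LHS](@vsubmxK _ 3 3 _ v) mul_block_col.
  by rewrite !mul0mx mulNmx !mul1mx add0r addr0.
by rewrite col_mxEu col_mxEd !mxE.
Qed.

Lemma J_mxK (K : pzRingType) : J_mx K *m J_mx K = - 1%:M.
Proof.
rewrite mulmx_block !mul0mx !mulmx0 mulmx1 mul1mx !add0r !addr0.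
by rewrite [in RHS](@scalar_mx_block _ 3 3) opp_block_mx !oppr0.
Qed.

Lemma tr_J_mx (K : pzRingType) : (J_mx K)^T = - J_mx K.
Proof. by rewrite tr_block_mx opp_block_mx linearN /= !trmx0 trmx1 !oppr0 opprK. Qed.

Lemma w_stdE (v : 'I_2 -> 'cV[R]_6) : w_std R v =
  \sum_(r <- iota 0 3) (v 0 (inord r) 0 * v 1 (inord (3 + r)) 0
                        - v 1 (inord r) 0 * v 0 (inord (3 + r)) 0).
Proof.
rewrite w_std_detform; apply: eq_bigr => r _.
rewrite /detform (expand_det_row _ ord0) !big_ord_recl big_ord0 /cofactor.
rewrite !det_mx11 !mxE /coord_rows /= (_ : lift ord0 ord0 = 1); last exact/val_inj.
rewrite (_ : lift 1 0 = 0); last exact/val_inj.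
rewrite /bump /pair_row /= expr0 expr1; ring.
Qed.

(** The standard metric is Euclidean; all metric conditions on the deformed structure are reduced to
    this formula. *)
Lemma w_std_J (u v : 'cV[R]_6) :
  w_std R (vec2 u (J_std R *m v)) = (u^T *m v) 0 0.
Proof.
rewrite w_stdE -[iota 0 3]/(index_iota 0 3) big_mkord mxE.
rewrite (@big_split_ord _ _ _ 3 3) /= -big_split /=; apply: eq_bigr => r _ /=.
have [-> ->] := J_mx_mul v (ltn_ord r).
rewrite !mxE.
have -> : inord r = lshift 3 r.
  by apply/val_inj; rewrite /= inordK // (leq_trans (ltn_ord r)).
have -> : inord (3 + r) = rshift 3 r.
  by apply/val_inj; rewrite /= inordK // -[6%N]/(3 + 3)%N ltn_add2l.
ring.
Qed.

Lemma alternating_w_std : alternating (w_std R).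
Proof.
rewrite w_std_detform; apply: alternating_sum => r; split=> [v j c u w|].
  apply: (@detform_updD _ _ _ _ id) => i c' u' w'; rewrite /coord_rows !mxE //.
exact: detform_eq0.
Qed.

Lemma zrowsP i c (u w : 'cV[R]_6) :
  zrows i (c *: u + w) = c%:C * zrows i u + zrows i w.
Proof.
by apply/eqP; rewrite eq_complex /= !mxE; apply/andP; split; apply/eqP; ring.
Qed.

Lemma alternating_psi_std :
  alternating (Re_form (psi_std R)) /\ alternating (Im_form (psi_std R)).
Proof.
have aD := @detform_updD R 6 3 _ (fun c => c%:C) _ zrowsP.
have a0 := @detform_eq0 R 6 3 _ (@zrows R).
rewrite psi_std_detform; split; split=> [v j c u w|v i j ij vij];
  rewrite /Re_form /Im_form /scale_form ?(a0 _ _ _ ij vij) ?mulr0 // aD;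
  by case: (detform 3 _ _) => ? ?; case: (detform 3 _ _) => ? ? /=; ring.
Qed.

End StandardPointwise.

(** * The deformed structure *)

Section Dilation.
Context {R : realType}.
Implicit Types (a : R).

(* [dil a] is the matrix [D] at a point where the exponent takes the value [a]. *)
Definition weight (i : nat) : R := [:: 1; -1; 0; -1; 1; 0]`_i.

Definition dil a : 'M[R]_6 := diag_mx (\row_i expR (weight i * a)).

Definition Jdil a : 'M[R]_6 := dil (- a) *m J_std R *m dil a.

Lemma dilE a (v : 'cV[R]_6) (i : 'I_6) :
  (dil a *m v) i 0 = expR (weight i * a) * v i 0.
Proof. by rewrite mul_diag_mx !mxE. Qed.

Lemma dil_inordE a (v : 'cV[R]_6) k : (k < 6)%N ->
  (dil a *m v) (inord k) 0 = expR (weight k * a) * v (inord k) 0.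
Proof. by move=> k6; rewrite dilE inordK. Qed.

Lemma dil0 : dil 0 = 1%:M.
Proof.
by apply/matrixP => i j; rewrite !mxE mulr0 expR0.
Qed.

Lemma dilK a : dil a *m dil (- a) = 1%:M.
Proof.
apply/matrixP => i j; rewrite mul_diag_mx !mxE.
by rewrite mulrnAr mulrN -expRD subrr expR0.
Qed.

Lemma dilVK a : dil (- a) *m dil a = 1%:M.
Proof. by have := dilK (- a); rewrite opprK. Qed.

Lemma JdilE a i j :
  Jdil a i j = expR (weight i * - a) * J_std R i j * expR (weight j * a).
Proof. by rewrite /Jdil mul_mx_diag mul_diag_mx !mxE. Qed.

Lemma dil_J a : dil a *m Jdil a = J_std R *m dil a.
Proof. by rewrite /Jdil !mulmxA dilK mul1mx. Qed.

Lemma JdilK a : Jdil a *m Jdil a = - 1%:M.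
Proof.
rewrite /Jdil -!mulmxA (mulmxA (dil a)) dilK mul1mx (mulmxA (J_std R)).
by rewrite (J_mxK R : J_std R *m J_std R = _) mulNmx mul1mx mulmxN dilVK.
Qed.

(** The weights of the conjugate coordinates [r] and [3 + r] are opposite, so the dilation is
    symplectic. *)
Lemma pull_w_std a : pull (dil a) (w_std R) = w_std R.
Proof.
apply/funext => v; rewrite /pull !w_stdE; apply: eq_big_seq => r.
rewrite mem_iota /= => r3; rewrite !dil_inordE ?(ltn_trans r3) //;
  try by rewrite -[6%N]/(3 + 3)%N ltn_add2l.
have E : expR (weight r * a) * expR (weight (3 + r) * a) = 1.
  rewrite -expRD -mulrDl; suff -> : weight r + weight (3 + r) = 0.
    by rewrite mul0r expR0.
  by move: r r3 => [|[|[|]]] //= _; rewrite /weight /= ?addr0 ?subrr ?addNr.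
have F (x y z t : R) : x * z * (y * t) = x * y * (z * t) by ring.
by rewrite F E mul1r F E mul1r.
Qed.

(** The dilation preserves [w_std] and intertwines [Jdil a] with [J_std], so the metric is the
    Euclidean one pulled back. *)
Lemma Jdil_metric a (u v : 'cV[R]_6) :
  w_std R (vec2 u (Jdil a *m v)) = ((dil a *m u)^T *m (dil a *m v)) 0 0.
Proof.
rewrite -w_std_J -[in LHS](pull_w_std a) /pull mulmx_vec2.
by rewrite !mulmxA dilK mul1mx.
Qed.

Lemma dil_inj a (u : 'cV[R]_6) : dil a *m u = 0 -> u = 0.
Proof. by move=> /(congr1 (mulmx (dil (- a)))); rewrite mulmxA dilVK mul1mx mulmx0. Qed.

Lemma Jdil_metric_pos a (u : 'cV[R]_6) :
  u != 0 -> 0 < w_std R (vec2 u (Jdil a *m u)).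
Proof.
move=> u0; have {u0} : dil a *m u != 0 by apply: contra_neq u0 => /dil_inj.
rewrite Jdil_metric; move: (dil a *m u) => {}u u0.
have -> : (u^T *m u) 0 0 = \sum_i u i 0 ^+ 2.
  by rewrite mxE; apply: eq_bigr => i _; rewrite mxE expr2.
rewrite lt_neqAle sumr_ge0 ?andbT => [|i _]; last exact: sqr_ge0.
rewrite eq_sym psumr_eq0 => [|i _]; last exact: sqr_ge0.
apply: contra_neqN u0 => /allP H; apply/matrixP => i j; rewrite (ord1 j) mxE.
by apply/eqP; rewrite -sqrf_eq0; apply: H; rewrite mem_index_enum.
Qed.

Lemma Jdil_calibrated (a : 'cV[R]_6 -> R) :
  calibrated (fun=> w_std R) (fun x => Jdil (a x)).
Proof.
move=> x; rewrite /calibrated_metric; split=> [u v|u|u v].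
- by rewrite !Jdil_metric !mxE; apply: eq_bigr => i _; rewrite !mxE mulrC.
- exact: Jdil_metric_pos.
have E w : dil (a x) *m (Jdil (a x) *m w) = J_std R *m (dil (a x) *m w).
  by rewrite !mulmxA dilK mul1mx.
rewrite !Jdil_metric !E trmx_mul -mulmxA (mulmxA _^T (J_std R)).
by rewrite (tr_J_mx R : (J_std R)^T = _) mulNmx (J_mxK R : J_std R *m J_std R = _)
  opprK mul1mx.
Qed.

Lemma w_std_nondegenerate : nondegenerate2 (w_std R).
Proof.
(* A nonzero [u] pairs positively with [Jdil 0 *m u]; any other exponent would serve equally. *)
move=> u Hu; apply/eqP/negPn/negP => /(@Jdil_metric_pos 0).
by rewrite Hu ltxx.
Qed.

Lemma pull_psi_std a : pull (dil a) (psi_std R) =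
  scale_form (iC R) (detform 3 (fun i u => zrows i (dil a *m u))).
Proof. by rewrite psi_std_detform. Qed.

Lemma pull_psi_std_neq0 a : exists v, pull (dil a) (psi_std R) v <> 0.
Proof.
(* The dilation sends these vectors to the first three coordinate vectors, on which the dz rows form
   the identity matrix. *)
exists (fun i => dil (- a) *m delta_mx (inord i) 0).
rewrite pull_psi_std /scale_form /detform.
set M := (X in \det X); have -> : M = 1%:M.
  apply/matrixP => i j; rewrite !mxE mulmxA dilK mul1mx /zrows !mxE.
  have i6 : (i < 6)%N by rewrite (leq_trans (ltn_ord i)).
  have j6 : (j < 6)%N by rewrite (leq_trans (ltn_ord j)).
  have i3 : (3 + i < 6)%N by rewrite -[6%N]/(3 + 3)%N ltn_add2l.
  rewrite -!val_eqE /= !inordK // (gtn_eqF (ltn_addr i (ltn_ord j))).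
  by case: (i == j :> nat); apply/eqP;
    rewrite eq_complex /= !(mulr0, mul0r, addr0, subr0) !eqxx.
rewrite det1 mulr1 => /eqP; rewrite eq_complex /= => /andP[_]; exact/negP/oner_neq0.
Qed.

(** If [S] is not everything, some slot holds a (0,1)-vector. Its image under the dilation is a
    (0,1)-vector for [J_std], on which every dz row vanishes, so the determinant has a zero
    column. *)
Lemma pull_psi_std_type a : @has_type R 6 3 0 (Jdil a) (pull (dil a) (psi_std R)).
Proof.
move=> S z Jz S3.
have [j jS] : exists j, j \notin S.
  apply/existsP; rewrite -negb_forall; apply: contra_notN S3 => /forallP H.
  have -> : S = [set: 'I_(3 + 0)] by apply/setP => j; rewrite inE H.
  by rewrite cardsT card_ord.
rewrite pull_psi_std.
transitivity (iC R * Cextend (detform 3 (fun i u => zrows i (dil a *m u))) z).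
  rewrite /Cextend big_distrr /=; apply: eq_bigr => T _; rewrite /scale_form.
  exact: mulrCA.
rewrite Cextend_detform; apply/eqP; rewrite mulf_eq0; apply/orP; right.
pose y := map_mx (real_complex R) (dil a) *m z j.
have Jy : J_mx R[i] *m y = - iC R *: y.
  have := Jz j; rewrite (negPf jS) => /(congr1 (mulmx (map_mx (real_complex R) (dil a)))).
  rewrite mulmxA -map_mxM dil_J map_mxM -mulmxA -/y -scalemxAr -/y => <-.
  congr (_ *m _); apply/esym/(etrans (map_block_mx _ _ _ _ _)).
  by rewrite !raddf0 raddfN /= map_mx1.
have zE : z j = map_mx (real_complex R) (map_mx (@complex.Re R) (z j)) +
    iC R *: map_mx (real_complex R) (map_mx (@complex.Im R) (z j)).
  apply/matrixP => k l; rewrite !mxE; case: (z j k l) => p q.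
  by apply/eqP; rewrite eq_complex /= !(mul0r, mulr0, mul1r, subr0, addr0, add0r) !eqxx.
have yE k : y k 0 = ((dil a *m map_mx (@complex.Re R) (z j)) k 0)%:C +
    iC R * ((dil a *m map_mx (@complex.Im R) (z j)) k 0)%:C.
  by rewrite /y [in LHS]zE mulmxDr -scalemxAr -!map_mxM !mxE.
rewrite (expand_det_col _ j) big1 // => i _; rewrite !mxE.
have [yi _] := J_mx_mul y (ltn_ord i).
move: yi; rewrite Jy mxE !yE => yi.
(* With [p + iC R * q] and [r + iC R * s] the coordinates [i] and [3 + i] of [y], the eigenvector
   equation says that the second is i times the first, so dz vanishes on [y]. *)
have E (p q r s : R[i]) : - iC R * (p + iC R * q) = - (r + iC R * s) ->
    p + iC R * r + iC R * (q + iC R * s) = 0.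
  rewrite mulNr => /oppr_inj H.
  transitivity (p + iC R * q + iC R * (r + iC R * s)); first by ring.
  by rewrite -H mulrA -expr2 (sqr_i R : iC R ^+ 2 = -1) mulN1r subrr.
by rewrite /zrows (E _ _ _ _ yi) mul0r.
Qed.

(** The domain [V] is left general to cover both the torus at fixed t and the joint variable (t,
    x). *)
Lemma smooth_Jdil (V : normedModType R) (h : V -> R) :
  smooth h -> smooth (fun x => Jdil (h x)).
Proof.
move=> sh; apply: smooth_mx => i j.
rewrite (_ : (fun x => _) = fun x => expR (weight i * - h x) * J_std R i j *
    expR (weight j * h x)); last by apply/funext => x; rewrite JdilE.
apply: smoothM; last by apply: smooth_expR; apply: smoothM => //; exact: smooth_cst.
apply: smoothM; last exact: smooth_cst.
by apply: smooth_expR; apply: smoothM; [exact: smooth_cst|exact: smoothN].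
Qed.

Lemma smooth_pull_psi_std (V : normedModType R) (h : V -> R) :
  smooth h -> smooth_Cform (fun x => pull (dil (h x)) (psi_std R)).
Proof.
move=> sh; suff H v : Csmooth (fun x => pull (dil (h x)) (psi_std R) v).
  by split=> v; have [] := H v.
rewrite (_ : (fun x => _) = fun x => iC R *
    detform 3 (fun i u => zrows i (dil (h x) *m u)) v); last first.
  by apply/funext => x; rewrite pull_psi_std.
apply: CsmoothM; first exact: Csmooth_cst.
apply: Csmooth_det => i j.
have S (k : 'I_6) : smooth (fun x => (dil (h x) *m v j) k 0).
  rewrite (_ : (fun x => _) = fun x => expR (weight k * h x) * v j k 0); last first.
    by apply/funext => x; rewrite dilE.
  apply: smoothM; last exact: smooth_cst.
  by apply: smooth_expR; apply: smoothM => //; exact: smooth_cst.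
rewrite (_ : (fun x => _) = fun x => ((dil (h x) *m v j) (inord i) 0)%:C +
    iC R * ((dil (h x) *m v j) (inord (3 + i)) 0)%:C); last first.
  by apply/funext => x; rewrite mxE.
apply: CsmoothD; last apply: CsmoothM; try exact: Csmooth_cst;
  by split=> //=; exact: smooth_cst.
Qed.

Lemma dil_SU3_structure (h : 'cV[R]_6 -> R) :
  smooth h -> Zperiodic h ->
  SU3_structure (fun=> w_std R) (fun x => Jdil (h x))
    (fun x => pull (dil (h x)) (psi_std R)).
Proof.
move=> sh ph; have [altr alti] := @alternating_psi_std R.
have [sr si] := smooth_pull_psi_std sh.
split.
- split=> [x|v|//]; [exact: alternating_w_std|exact: smooth_cst].
- by move=> x; exact: w_std_nondegenerate.
- by split=> [|x m|x]; [exact: smooth_Jdil|rewrite ph|exact: JdilK].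
- exact: Jdil_calibrated.
- split; split=> // [x|x m]; rewrite ?ph //.
    exact: (alternating_pull (dil (h x)) altr).
  exact: (alternating_pull (dil (h x)) alti).
- by move=> x; exact: pull_psi_std_neq0.
- by move=> x; exact: pull_psi_std_type.
(* Since [w_std] is its own pullback, both sides are standard forms evaluated on [u], and the
   identity becomes 8i = -(4/3) i (-6). *)
move=> x v; set u := fun i => dil (h x) *m v i.
have W : wedge (wedge (w_std R) (w_std R)) (w_std R) v =
    - 6%:R * \det (\matrix_(i < 6, j < 6) u j i 0).
  by rewrite -{1 2 3}(pull_w_std (h x)); exact: (w_std_cubed u).
rewrite [LHS](psi_std_volume u) /scale_form /complexify_form W.
rewrite rmorphM rmorphN rmorph_nat /=.
have E (c d : R[i]) : 8%:R * c * d = - (4%:R / 3%:R) * c * (- 6%:R * d).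
  by field.
exact: E.
Qed.

End Dilation.

(** * Exterior derivatives of forms with coefficients in one coordinate *)

Section Closedness.
Context {R : realType}.

Lemma derive_bigsum (V : normedModType R) (I : Type) (r : seq I)
    (F : I -> V -> R) x u :
  (forall i, smooth (F i)) ->
  'D_u (fun y => \sum_(i <- r) F i y) x = \sum_(i <- r) 'D_u (F i) x.
Proof.
move=> sF; elim: r => [|i r IH].
  rewrite big_nil -[RHS](derive_cst (0 : R) x u); congr ('D_u _ x).
  by apply/funext => y; rewrite big_nil.
rewrite big_cons -IH -deriveD; first 1 last.
- by apply: diff_derivable; have [] := sF i 1.
- by apply: diff_derivable; have [] := Ck_sum r (fun i => sF i 1).
by congr ('D_u _ x); apply/funext => y; rewrite big_cons.
Qed.

Lemma closed_form_sum n k (I : eqType) (r : seq I)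
    (a : I -> 'cV[R]_n.+1 -> extform R n.+1 k R) :
  (forall i, smooth_form (a i)) -> {in r, forall i, closed_form (a i)} ->
  closed_form (fun x v => \sum_(i <- r) a i x v).
Proof.
move=> sa ca x v; rewrite /ext_d.
under eq_bigr => j _.
  rewrite (derive_bigsum r (F := fun i y => a i y (fun l => v (lift j l)))).
    by rewrite big_distrr; over.
  by move=> i; exact: sa.
by rewrite exchange_big big1_seq // => i /andP[_ ir]; exact: ca.
Qed.

(** Chain rule through the linear coordinate function. Values in [W] cover form coefficients as well
    as vector fields such as J d_1. *)
Lemma derive_coord n (W : normedModType R) (g : R -> R) (c : W) (i : 'I_n.+1)
    (x u : 'cV[R]_n.+1) :
  (forall s, differentiable g s) ->
  'D_u (fun y : 'cV[R]_n.+1 => g (y i 0) *: c) x = (u i 0 * 'D_1 g (x i 0)) *: c.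
Proof.
move=> dg.
have L : linear (fun y : 'cV[R]_n.+1 => y i 0) by move=> ? ? ?; rewrite !mxE.
pose l : {linear 'cV[R]_n.+1 -> R} := HB.pack (fun y : 'cV[R]_n.+1 => y i 0)
  (GRing.isLinear.Build R _ _ _ _ L).
have cl : continuous l by exact: coord_continuous.
have dl y : differentiable l y by exact: linear_differentiable.
have dgl : differentiable (g \o l) x by exact: differentiable_comp.
rewrite deriveE; last exact: (@differentiableZl _ _ _ (g \o l)).
rewrite (@diffZl _ _ _ (g \o l)) // diff_comp //= (@diff_lin _ _ _ l) //=.
by rewrite deriv1E ?derive1E //; apply/derivable1_diffP.
Qed.

(* d(g dx_f) = g' dx_m /\ dx_f, which vanishes if dx_m occurs in dx_f. *)
Lemma closed_coord_form n k (g : R -> R) (m : 'I_n.+1)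
    (c : nat -> 'I_n.+1) :
  (forall s, differentiable g s) ->
  (forall s, 'D_1 g s = 0) \/ (exists2 i, (i < k)%N & c i = m) ->
  closed_form (fun (x : 'cV[R]_n.+1) v =>
    g (x m 0) * detform k (fun i u => u (c i) 0) v).
Proof.
move=> dg gc x v; rewrite /ext_d.
under eq_bigr => j _ do rewrite (derive_coord _ _ _ _ dg).
have [g0|[i ik ci]] := gc.
  by rewrite big1 // => j _; rewrite g0 mulr0 scale0r mulr0.
(* Row 0 is dx_m and the rows below are those of the given form; expansion along row 0 reproduces
   the sum in [ext_d]. *)
pose A := \matrix_(l < k.+1, j < k.+1) v j (if val l is l'.+1 then c l' else m) 0.
transitivity ('D_1 g (x m 0) * \det A).
  rewrite (expand_det_row _ ord0) big_distrr; apply: eq_bigr => j _ /=.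
  rewrite mxE /cofactor add0n.
  rewrite [X in _ * (_ * (_ * \det X))](_ : _ =
    \matrix_(l < k, q < k) v (lift j q) (c l) 0); last first.
    by apply/matrixP => l q; rewrite !mxE.
  have E (s y z t : R) : s * (y * z * t) = z * (y * (s * t)) by ring.
  exact: E.
suff -> : \det A = 0 by rewrite mulr0.
apply: (@determinant_alternate _ _ _ ord0 (lift ord0 (Ordinal ik))) => // j.
by rewrite !mxE /= ci.
Qed.

Lemma detform_laplace n (K : comPzRingType) k (a : nat -> 'cV[R]_n -> K) v :
  detform k.+1 a v = laplace k.+1 (fun i j => a i (v (inord j))).
Proof.
rewrite -det_laplace; congr (\det _); apply/matrixP => i j.
by rewrite !mxE inord_val.
Qed.

(* Coefficients and zero-based row indices of
   [dx_456 - dx_126 - dx_153 - dx_423]. *)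
Definition Re_psi_terms : seq (R * seq nat) :=
  [:: (1, [:: 3; 4; 5]%N); (-1, [:: 0; 1; 5]%N);
      (-1, [:: 0; 4; 2]%N); (-1, [:: 3; 1; 2]%N)].

Lemma Re_psi_std (v : 'I_3 -> 'cV[R]_6) : Re_form (psi_std R) v =
  \sum_(k <- Re_psi_terms) k.1 * detform 3 (coord_rows (nth 0%N k.2)) v.
Proof.
rewrite psi_std_detform /Re_form /scale_form !big_cons big_nil !detform_laplace.
rewrite /laplace /coord_rows /= /bump /=.
ring.
Qed.

End Closedness.

(** * The exponent t sin(2 pi x_3) and closedness of the real part *)

Section Family.
Context {R : realType}.

Definition wave (t s : R) : R := t * sin (pi *+ 2 * s).

(** Coordinates are zero-based, so [inord 2] selects x_3. *)
Definition amp (t : R) (x : 'cV[R]_6) : R := wave t (x (inord 2) 0).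

Lemma sin_Zperiodic (s : R) (m : int) :
  sin (pi *+ 2 * (s + m%:~R)) = sin (pi *+ 2 * s).
Proof.
have H n z : sin (pi *+ 2 * (z + n%:R)) = sin (pi *+ 2 * z) :> R.
  by rewrite mulrDr mulr_natr (periodicn (@sinD2pi R)).
case: m => n; first exact: H.
(* A negative shift is undone by the natural shift at the translated point. *)
by rewrite NegzE rmorphN /= -(H n.+1 (s - _)) subrK.
Qed.

Lemma Zperiodic_amp t : Zperiodic (amp t).
Proof. by move=> x m; rewrite /amp /wave !mxE sin_Zperiodic. Qed.

Lemma smooth_wave (V : normedModType R) (f g : V -> R) :
  smooth f -> smooth g -> smooth (fun x => wave (f x) (g x)).
Proof.
move=> sf sg; apply: smoothM => //.
suff [] : smooth (fun x => sin (pi *+ 2 * g x)) /\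
  smooth (fun x => cos (pi *+ 2 * g x)) by [].
by apply: smooth_sin_cos; apply: smoothM => //; exact: smooth_cst.
Qed.

Lemma smooth_amp t : smooth (amp t).
Proof. by apply: smooth_wave; [exact: smooth_cst|exact: smooth_coord]. Qed.

Lemma smooth_amp2 : smooth (fun p : R * 'cV[R]_6 => amp p.1 p.2).
Proof.
apply: smooth_wave; apply: smooth_linear.
- by [].
- by move=> p; exact: cvg_fst.
- by move=> c p q; rewrite !mxE.
move=> p; apply: (@continuous_comp _ _ _ snd (fun x : 'cV[R]_6 => x (inord 2) 0)).
  exact: cvg_snd.
exact: coord_continuous.
Qed.

(** The dilation rescales each coordinate row, so a monomial form is multiplied by the determinant
    of a diagonal matrix. *)
Lemma detform_dil k (a : R) f (v : 'I_k -> 'cV[R]_6) :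
  (forall i, (i < k)%N -> (f i < 6)%N) ->
  detform k (coord_rows f) (fun j => dil a *m v j) =
  expR ((\sum_(i < k) weight (f i)) * a) * detform k (coord_rows f) v.
Proof.
move=> f6; rewrite mulr_suml expR_sum.
have := det_diag (\row_(i < k) expR (weight (R := R) (f i) * a)).
under eq_bigr do rewrite mxE.
move=> <-; rewrite -det_mulmx; congr (\det _); apply/matrixP => i j.
by rewrite mul_diag_mx !mxE /coord_rows dil_inordE ?f6.
Qed.

Lemma Re_psi_closed t :
  closed_form (fun x => Re_form (pull (dil (amp t x)) (psi_std R))).
Proof.
pose W (k : R * seq nat) : R := \sum_(i < 3) weight (nth 0%N k.2 i).
pose a (k : R * seq nat) (x : 'cV[R]_6) : extform R 6 3 R :=
  fun v => k.1 * expR (W k * amp t x) * detform 3 (coord_rows (nth 0%N k.2)) v.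
have -> : (fun x => Re_form (pull (dil (amp t x)) (psi_std R))) =
    fun x v => \sum_(k <- Re_psi_terms) a k x v.
  apply/funext => x; apply/funext => v.
  rewrite -[LHS]/(Re_form (psi_std R) (fun i => dil (amp t x) *m v i)) Re_psi_std.
  apply: eq_big_seq => k kin; rewrite detform_dil => [|i i3]; first exact: mulrA.
  move: kin; rewrite !inE => /or4P[] /eqP-> /=;
  by move: i i3 => [|[|[|]]].
apply: closed_form_sum => [k v|k kin].
  apply: smoothM; last exact: smooth_cst.
  apply: smoothM; first exact: smooth_cst.
  apply: smooth_expR; apply: smoothM; first exact: smooth_cst.
  exact: smooth_amp.
apply: (@closed_coord_form _ 5 3 (fun s => k.1 * expR (W k * wave t s)) (inord 2)
  (fun i => inord (nth 0%N k.2 i))).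
  move=> s; have sm : smooth (fun s => k.1 * expR (W k * wave t s)).
    apply: smoothM; first exact: smooth_cst.
    apply: smooth_expR; apply: smoothM; first exact: smooth_cst.
    apply: smooth_wave; first exact: smooth_cst.
    by apply: smooth_linear => // x; exact: cvg_id.
  by have [] := sm 1.
have W0 : W k = 0 -> forall s, 'D_1 (fun s => k.1 * expR (W k * wave t s)) s = 0.
  move=> -> s; rewrite -[RHS](derive_cst (k.1 : R) s 1); congr ('D_1 _ s).
  by apply/funext => y; rewrite mul0r expR0 mulr1.
(* The terms dx_456 and dx_126 have total weight 0, hence constant coefficients. The other two have
   weights 2 and -2 but contain dx_3, at position 2 of their index lists. *)
move: kin; rewrite !inE => /or4P[] /eqP kE.
- by left; apply: W0; rewrite /W kE !big_ord_recl big_ord0 /weight /=; ring.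
- by left; apply: W0; rewrite /W kE !big_ord_recl big_ord0 /weight /=; ring.
- by right; exists 2%N; rewrite ?kE.
- by right; exists 2%N; rewrite ?kE.
Qed.

(** * Coordinate vectors and non-integrability *)

Definition evec k : 'cV[R]_6 := delta_mx (inord k) 0.

Lemma evecE k l : (k < 6)%N -> (l < 6)%N -> evec k (inord l) 0 = (l == k)%:R.
Proof. by move=> k6 l6; rewrite mxE -val_eqE /= !inordK ?andbT. Qed.

Lemma dil_delta (a : R) k : (k < 6)%N ->
  dil a *m evec k = expR (weight k * a) *: evec k.
Proof.
move=> k6; apply/matrixP => i j; rewrite (ord1 j) dilE !mxE.
have [->|_] := eqVneq i (inord k); first by rewrite inordK.
by rewrite !mulr0.
Qed.

Lemma J_std_delta r : (r < 3)%N ->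
  J_std R *m evec r = evec (3 + r).
Proof.
move=> r3; apply/matrixP => i j; rewrite (ord1 j).
have lt6 k : (k < 3)%N -> (k < 6)%N /\ (3 + k < 6)%N.
  by move=> k3; split; [exact: ltn_trans k3 _|rewrite -[6%N]/(3 + 3)%N ltn_add2l].
have [i3|i3] := ltnP i 3.
  rewrite -(inord_val i).
  have [-> _] := J_mx_mul (evec r) i3.
  have [? ?] := lt6 _ i3; have [? ?] := lt6 _ r3.
  rewrite !mxE -!val_eqE /= !inordK //.
  by rewrite (gtn_eqF (ltn_addr i r3)) (ltn_eqF (ltn_addr r i3)) oppr0.
have {i3} [k k3 ->] : exists2 k, (k < 3)%N & i = inord (3 + k).
  exists (i - 3)%N; first by rewrite ltn_subLR // ltn_ord.
  by rewrite subnKC // inord_val.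
have [_ ->] := J_mx_mul (evec r) k3.
have [? ?] := lt6 _ k3; have [? ?] := lt6 _ r3.
by rewrite !mxE -!val_eqE /= !inordK // eqn_add2l.
Qed.

Lemma Jdil_delta (a : R) r : (r < 3)%N ->
  Jdil a *m evec r =
  expR ((weight r - weight (3 + r)) * a) *: evec (3 + r).
Proof.
move=> r3; rewrite /Jdil -!mulmxA dil_delta ?(ltn_trans r3) // -!scalemxAr.
rewrite J_std_delta // dil_delta; last by rewrite -[6%N]/(3 + 3)%N ltn_add2l.
by rewrite scalerA -expRD mulrBl mulrN.
Qed.

(** At the origin the sine vanishes, so the exponential and cosine factors of the chain rule are
    both 1. *)
Lemma derive_exp_wave (c t : R) :
  is_derive (0 : R) 1 (fun s => expR (c * wave t s)) (c * (t * (pi *+ 2))).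
Proof.
have H : is_derive (0 : R) 1 (fun s : R => pi *+ 2 * s) (pi *+ 2).
  by apply: is_derive_eq; rewrite scaler1.
have H1 : is_derive (0 : R) 1 (fun s : R => sin (pi *+ 2 * s)) (pi *+ 2).
  have := @is_derive1_comp R sin _ 0 _ _ (is_derive_sin _) H.
  by rewrite mulr0 cos0 mul1r.
have H2 : is_derive (0 : R) 1 (fun s : R => c * wave t s) (c * (t * (pi *+ 2))).
  rewrite (_ : (fun s => _) = (fun s : R => (c * t) *: sin (pi *+ 2 * s))).
    by apply: is_derive_eq; rewrite /GRing.scale /= mulrA.
  by apply/funext => s; rewrite /wave mulrA.
have := @is_derive1_comp R expR _ 0 _ _ (is_derive_expR _) H2.
by rewrite /wave mulr0 sin0 !mulr0 expR0 mul1r.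
Qed.

Lemma not_integrable_Jdil t : t <> 0 -> ~ integrable_acs (fun x => Jdil (amp t x)).
Proof.
move=> t0 /(_ (fun=> evec 0) (fun=> evec 2)).
have cst_field (u : 'cV[R]_6) : torus_field (fun=> u).
  by split=> //; exact: smooth_cst.
move=> /(_ (cst_field _) (cst_field _) 0).
pose g (s : R) := expR (2%:R * wave t s).
have dg s : differentiable g s.
  have sm : smooth g.
    apply: smooth_expR; apply: smoothM; first exact: smooth_cst.
    apply: smooth_wave; first exact: smooth_cst.
    by apply: smooth_linear => // x; exact: cvg_id.
  by have [] := sm 1.
have JX : Jact (fun x => Jdil (amp t x)) (fun=> evec 0) =
    fun y => g (y (inord 2) 0) *: evec 3.
  have w0 : weight 0 - weight (3 + 0) = 2%:R :> R by rewrite /weight /=; ring.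
  by apply/funext => y; rewrite /Jact Jdil_delta // w0.
have JY : Jact (fun x => Jdil (amp t x)) (fun=> evec 2) =
    fun=> evec 5.
  apply/funext => y; rewrite /Jact Jdil_delta //.
  by rewrite /weight /= subrr mul0r expR0 scale1r.
rewrite /nijenhuis /lie JX JY !derive_cst !(derive_coord _ _ _ _ dg).
rewrite !evecE // eqxx /=.
rewrite !mul0r !scale0r !subr0 !mulmx0 !sub0r !subr0 mul1r.
(* As [g] depends on x_3 only, [J d_1, d_3] is the only nonzero bracket and the tensor equals J
   applied to g'(0) d_4. Applying J once more removes it without computing J d_4, leaving g'(0) = 4
   pi t to be refuted. *)
rewrite mulmxN opprK => /(congr1 (mulmx (Jdil (amp t 0)))).
rewrite mulmxA JdilK mulNmx mul1mx mulmx0 => /eqP; rewrite oppr_eq0 => /eqP.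
move=> /matrixP/(_ (inord 3) 0); rewrite mxE evecE // !mxE mulr1.
have -> : 'D_1 g 0 = 2%:R * (t * (pi *+ 2)).
  by have dg0 := derive_exp_wave 2%:R t; rewrite derive_val.
apply/eqP; rewrite !mulf_neq0 ?pnatr_eq0 //; first exact/eqP.
by rewrite mulrn_eq0 /= gt_eqF ?pi_gt0.
Qed.

End Family.

Theorem theorem3p3 (R : realType) :
  exists (w : R -> 'cV[R]_6 -> extform R 6 2 R) (J : R -> 'cV[R]_6 -> 'M[R]_6)
         (psi : R -> 'cV[R]_6 -> extform R 6 3 (complex R)),
    smooth_family w J psi /\
    (forall t, symplectic_half_flat (w t) (J t) (psi t)) /\
    (forall x, w 0%R x = w_std R /\ J 0%R x = J_std R /\
               psi 0%R x = psi_std R) /\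
    (forall t, t <> 0%R -> ~ integrable_acs (J t)).
Proof.
(* The 2-form stays constant because the dilations are symplectic; only [J] and [psi] vary with
   t. *)
exists (fun _ _ => w_std R), (fun t x => Jdil (amp t x)),
  (fun t x => pull (dil (amp t x)) (psi_std R)).
split; last split; last split.
- split; first by move=> v; exact: smooth_cst.
    exact: smooth_Jdil smooth_amp2.
  exact: smooth_pull_psi_std smooth_amp2.
- move=> t; split.
  + exact: dil_SU3_structure (smooth_amp t) (@Zperiodic_amp _ t).
  + move=> x v; rewrite /ext_d big1 // => j _.
    by rewrite derive_cst mulr0.
  + exact: Re_psi_closed.
- move=> x; have amp0 : amp 0 x = 0 by rewrite /amp /wave mul0r.
  rewrite amp0 /Jdil oppr0 dil0 mul1mx mulmx1; split=> //; split=> //.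
  apply/funext => v; rewrite /pull; congr (psi_std R _).
  by apply/funext => i; rewrite mul1mx.
- exact: not_integrable_Jdil.
Qed.
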